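(* Let $U\subseteq\mathbb{N}$ be avoidable with respect to $(\mathbb{N},+)$ and suppose $U$ contains infinitely many even numbers. Then $U$ has arithmetic density $0$, i.e. $d(U)=\limsup_{n\to\infty}\frac{U(n)}{n}=0$, where $U(n)$ is the number of elements of $U$ less than $n$.
   Context: For a set $S$ with a binary operation, a subset $U\subseteq S$ is avoidable if there is a partition $\{A,B\}$ of $S$ such that no element of $U$ is the product (here: sum) of two distinct elements of $A$ or of two distinct elements of $B$. Here $S=\mathbb{N}$ with ordinary addition. *)

(* Defs.v *)
From mathcomp Require Import all_boot all_order all_algebra.
From mathcomp Require Import all_classical all_reals all_analysis.

Set Implicit Arguments.
Unset Strict Implicit.
Unset Printing Implicit Defensive.

Local Open Scope classical_set_scope.

Section Avoidable.
Variables (T : Type) (op : T -> T -> T).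

Definition distinct_product_free (U A : set T) : Prop :=
  forall x y, A x -> A y -> x <> y -> ~ U (op x y).

(* The two parts may be empty, which only makes avoidability easier. *)
Definition avoidable (S U : set T) : Prop :=
  U `<=` S /\
  exists A B : set T,
    [/\ A `|` B = S, A `&` B = set0,
        distinct_product_free U A & distinct_product_free U B].

End Avoidable.

(* The natural numbers start at 1.  If U is avoidable in {0, 1, 2, ...}, then
   U minus 0 is avoidable here and has the same density, so a bound on the
   density of avoidable sets for this convention covers the other one. *)
Definition posnat : set nat := [set n | 0 < n].

Definition even_numbers : set nat := [set n | ~~ odd n].

Definition count_below (U : set nat) (n : nat) : nat :=
  #|[pred k : 'I_n | (k : nat) \in U]|.

(* The term at n = 0 is 0 / 0 = 0; it does not affect the limsup. *)
Definition upper_density (R : realType) (U : set nat) : \bar R :=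
  limn_esup (fun n => ((count_below U n)%:R / n%:R)%:E)%R.

(* Main.v *)
Require Import Defs.
From mathcomp Require Import all_boot all_order all_algebra.
From mathcomp Require Import all_classical all_reals all_analysis.
From mathcomp Require Import zify lra.

Import Order.TTheory GRing.Theory Num.Theory numFieldNormedType.Exports.

Local Open Scope classical_set_scope.

(** If three distinct elements [a], [b], [c] of an avoidable set have an even
    sum and satisfy the triangle inequalities, then [a = x + y], [b = x + z],
    [c = y + z] with [x], [y], [z] distinct and positive, and two of [x], [y],
    [z] lie in the same part, a contradiction.  Hence, once [U] contains an even
    number [a], two elements of [U] beyond [a] of the same parity are at
    distance at least [a], so the upper density of [U] is at most [2 / a]; and
    [a] can be taken arbitrarily large. *)

Lemma avoidable_no_triangle (U : set nat) (x y z : nat) :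
  avoidable addn posnat U -> 0 < x -> x < y -> y < z ->
  U (x + y) -> U (x + z) -> U (y + z) -> False.
Proof.
move=> [_ [A [B [AB _ hA hB]]]] x0 xy yz Uxy Uxz Uyz.
have part t : 0 < t -> A t \/ B t by move=> t0; have : (A `|` B) t by rewrite AB.
have nxy : x <> y by lia.
have nxz : x <> z by lia.
have nyz : y <> z by lia.
have /part y0 : 0 < y by lia.
have /part z0 : 0 < z by lia.
by case: (part x x0) y0 z0 => ? [] ? [] ?;
  first [exact: (hA x y) | exact: (hA x z) | exact: (hA y z)
       | exact: (hB x y) | exact: (hB x z) | exact: (hB y z)].
Qed.

Lemma avoidable_gap (U : set nat) (a b c : nat) :
  avoidable addn posnat U -> U a -> ~~ odd a -> U b -> U c ->
  odd b = odd c -> a < b -> b < c -> a <= c - b.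
Proof.
move=> avU Ua ea Ub Uc obc ab bc; rewrite leqNgt; apply/negP => cba.
(* The solution of [x + y = a], [x + z = b], [y + z = c]. Halving is exact since [a] is even and
   [b], [c] have the same parity; [cba] gives [0 < x], and [a < b < c] gives [x < y < z]. *)
pose x := (a + b - c)./2; pose y := (a + c - b)./2; pose z := (b + c - a)./2.
have xya : x + y = a by rewrite /x /y; lia.
have xzb : x + z = b by rewrite /x /z; lia.
have yzc : y + z = c by rewrite /y /z; lia.
by apply: (@avoidable_no_triangle U x y z) => //; rewrite ?xya ?xzb ?yzc //; lia.
Qed.

Lemma count_below_le (U : set nat) (a n : nat) :
  avoidable addn posnat U -> U a -> ~~ odd a ->
  count_below U n <= a.+1 + (n %/ a).+1 * 2.
Proof.
move=> avU Ua ea.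
have a0 : 0 < a by apply: (avU.1 a).
(* Elements up to [a] are kept as they are; a later one is recorded by its block of length [a] and
   its parity. Two later elements with the same record would be less than [a] apart, against
   [avoidable_gap]. *)
pose f (k : 'I_n) : 'I_a.+1 + 'I_(n %/ a).+1 * bool :=
  if k <= a then inl (inord k) else inr (inord (k %/ a), odd k).
have finj : {in [pred k : 'I_n | (k : nat) \in U] &, injective f}.
  move=> i j; rewrite !inE => Ui Uj; rewrite /f.
  have quo (k : 'I_n) : k %/ a < (n %/ a).+1 by rewrite ltnS leq_div2r // ltnW.
  case: leqP => ia; case: leqP => ja // [].
    by move=> /(congr1 val) /=; rewrite !inordK // => /val_inj.
  move=> /(congr1 val) /=; rewrite !inordK // => qij oij; apply: val_inj => /=.
  have lt_gap (k l : nat) : k %/ a = l %/ a -> l - k < a.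
    by move=> q; have := divn_eq k a; have := divn_eq l a;
      have := ltn_pmod l a0; rewrite q; lia.
  have [ij|ji|//] := ltngtP (i : nat) j.
    by have := avoidable_gap U a i j avU Ua ea Ui Uj oij ia ij;
      have := lt_gap _ _ qij; lia.
  by have := avoidable_gap U a j i avU Ua ea Uj Ui (esym oij) ja ji;
    have := lt_gap _ _ (esym qij); lia.
rewrite /count_below -(card_in_image finj); apply: leq_trans (max_card _) _.
by rewrite card_sum card_prod !card_ord card_bool.
Qed.

Lemma infinite_set_nat_unbounded (V : set nat) (N : nat) :
  infinite_set V -> exists2 a, V a & N <= a.
Proof.
move=> infV; apply: contrapT => bd; apply: infV.
apply: (@sub_finite_set _ _ `I_N); last exact: finite_II.
by move=> k Vk /=; rewrite ltnNge; apply/negP => Nk; apply: bd; exists k.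
Qed.

Theorem theorem3p2 (R : realType) (U : set nat)
    (hU : avoidable addn posnat U)
    (hinf : infinite_set (U `&` even_numbers)) :
  upper_density R U = 0%E.
Proof.
suff cvg0 : ((count_below U n)%:R / n%:R : R)%R @[n --> \oo] --> (0 : R)%R.
  by rewrite /upper_density; apply: (cvg_limn_einf_sup _).2; apply: cvg_EFin cvg0;
    exact: nearW.
apply/cvgrPdist_le => e e0.
(* With [4 / e <= a], the contribution [2 * (n %/ a)] of the blocks is at most [n * e / 2]. *)
have [a [Ua ea] ale] := infinite_set_nat_unbounded _ (Num.bound (4 / e)%R) hinf.
have a_e : (4 <= a%:R * e)%R.
  rewrite -ler_pdivrMr //; apply: le_trans (ltW (archi_boundP _)) _.
    by rewrite divr_ge0 // ltW.
  by rewrite ler_nat.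
near=> n.
have n_gt0 : (0 < n%:R :> R)%R by rewrite ltr0n; near: n; exact: nbhs_infty_gt.
(* The other half of [e] absorbs the part [a + 3] of the bound, which does not depend on [n]. *)
have n_e : ((a + 3)%:R * 2 <= n%:R * e)%R.
  by rewrite -ler_pdivrMr //; near: n; exact: nbhs_infty_ger.
rewrite sub0r normrN ger0_norm ?divr_ge0 // ler_pdivrMr //.
have := count_below_le U a n hU Ua ea.
rewrite -(ler_nat R) => /le_trans; apply.
have : ((n %/ a)%:R * a%:R <= n%:R :> R)%R by rewrite -natrM ler_nat leq_divM.
rewrite -(ler_pM2r e0) -mulrA => q_e.
have q4 : ((n %/ a)%:R * 4 <= (n %/ a)%:R * (a%:R * e) :> R)%R.
  by apply: ler_wpM2l.
have -> : a.+1 + (n %/ a).+1 * 2 = a + 3 + (n %/ a) * 2 by lia.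
rewrite natrD natrM; lra.
Unshelve. all: by end_near.
Qed.
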